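(* Let $\mathcal{G} = \langle G_0, G_1, G_2, \dots\rangle$ be a dynamic graph and $k \ge 1$ an integer. The maintenance framework with parameter $k$ described in the context maintains a $k$-maximal independent set $I$ over $\mathcal{G}$; that is, for every $i$, when the framework terminates on the update producing $G_i$, its output $I$ is a $k$-maximal independent set of $G_i$.
   Context: Graphs are finite, simple, unweighted and undirected. $N(v)$ and $N[v]=N(v)\cup\{v\}$ are the open and closed neighbourhoods; for a vertex set $S$, $N[S]$ is $S$ together with all vertices having a neighbour in $S$. A dynamic graph is a sequence $\langle G_0, G_1, \dots\rangle$ where each $G_i$ ($i\ge1$) is obtained from $G_{i-1}$ by one update operation $op$: inserting a vertex (possibly with incident edges), deleting a vertex (with its incident edges), inserting an edge, or deleting an edge. Given an independent set $I$, a $j$-swap consists of removing $j$ vertices from $I$ and inserting at least $j+1$ vertices into it so that the result is again independent. $I$ is $k$-maximal if it is a maximal independent set and no $j$-swap is available for any $j\in\{1,\dots,k\}$. The framework is started with a $k$-maximal independent set of $G_0$. Notation: for the current solution $I$ and $v\notin I$, $I(v)=N(v)\cap I$ and $count(v)=|I(v)|$. For $S\subseteq I$ with $|S|=j\le k$, $\bar I_{\le j}(S)=\{v\notin I : 1\le count(v)\le j,\ I(v)\subseteq S\}$. Maintenance framework with parameter $k$ (processing update $op$ taking $G_{i-1}$ to $G_i$): (1) Apply $op$. If an edge was inserted between two vertices of $I$, remove one endpoint from $I$; if a vertex of $I$ was deleted, remove it from $I$; then add vertices with $count=0$ to $I$ until $I$ is a maximal independent set of $G_i$. (2) Initialize candidate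 collections $\mathcal{C}_1,\dots,\mathcal{C}_k$, where $\mathcal{C}_j$ holds pairs $(S,C(S))$ with $S\subseteq I$, $|S|=j$, $C(S)\subseteq \bar I_{\le j}(S)$: for each vertex $u\notin I$ in the closed neighbourhood of $op$ (the inserted/deleted vertex, or the endpoints of the inserted/deleted edge, together with their neighbours) with $1\le count(u)=j\le k$, insert $u$ into $C(I(u))$ and $I(u)$ into $\mathcal{C}_j$. (3) While some $\mathcal{C}_j$ is nonempty: let $j$ be the smallest index with $\mathcal{C}_j\neq\emptyset$ and remove a pair $(S,C(S))$ from $\mathcal{C}_j$ (pairs with $S\not\subseteq I$ are discarded). For $v\in C(S)$, check whether there is an independent set $I_S\subseteq \bar I_{\le j}(S)\setminus N[v]$ with $|I_S|=j$. If so: remove $S$ from $I$, insert $\{v\}\cup I_S$ into $I$, add vertices with $count=0$ until $I$ is maximal, and for every $u\in N[S]$, $u\notin I$, with $1\le count(u)=j'\le k$ insert $u$ into $C(I(u))$ and $I(u)$ into $\mathcal{C}_{j'}$; this pair is then finished. If no $v\in C(S)$ yields such a swap and $j+1\le k$, then for the sets $S'\subseteq I$ with $S\subset S'$, $|S'|=j+1$, insert the vertices of $C(S)$ into $C(S')$ and $S'$ into $\mathcal{C}_{j+1}$. (4) When all $\mathcal{C}_j$ are empty, output $I$ as the solution for $G_i$. *)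

(* Defs.v *)
(* Mathematical Components + finmap. *)
From Stdlib Require Import Relation_Operators.
From mathcomp Require Import all_boot finmap.

Set Implicit Arguments.
Unset Strict Implicit.
Unset Printing Implicit Defensive.

Local Open Scope fset_scope.

(* [V] is the universe of vertex names, possibly infinite, so that a dynamic
   graph may acquire new vertices for ever. *)
Record graph (V : choiceType) := Graph {
  verts : {fset V};
  adj : rel V;
  adj_verts : forall u v, adj u v -> u \in verts;
  adj_sym : symmetric adj;
  adj_irr : irreflexive adj
}.

Definition nbhd (V : choiceType) (G : graph V) (v : V) : {fset V} :=
  [fset u in verts G | adj G v u].

Definition cnbhd (V : choiceType) (G : graph V) (v : V) : {fset V} :=
  v |` nbhd G v.

Definition cnbhds (V : choiceType) (G : graph V) (S : {fset V}) : {fset V} :=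
  S `|` [fset u in verts G | [exists s : S, adj G u (val s)]].

Definition independent (V : choiceType) (G : graph V) (I : {fset V}) : Prop :=
  I `<=` verts G /\ forall u v, u \in I -> v \in I -> ~~ adj G u v.

Definition maximal_independent (V : choiceType) (G : graph V) (I : {fset V}) :
    Prop :=
  independent G I /\ forall J, independent G J -> I `<=` J -> J = I.

Definition swap_available (V : choiceType) (G : graph V) (I : {fset V})
    (j : nat) : Prop :=
  exists S T : {fset V},
    [/\ S `<=` I, #|` S| = j, [disjoint T & I], j.+1 <= #|` T|
      & independent G ((I `\` S) `|` T)].

Definition k_maximal (V : choiceType) (k : nat) (G : graph V) (I : {fset V}) :
    Prop :=
  maximal_independent G I /\
  forall j, 1 <= j <= k -> ~ swap_available G I j.

Inductive operation (V : choiceType) :=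
  | InsertVertex of V & {fset V}
  | DeleteVertex of V
  | InsertEdge of V & V
  | DeleteEdge of V & V.

Definition same_pair (V : eqType) (a b x y : V) : bool :=
  ((x == a) && (y == b)) || ((x == b) && (y == a)).

Definition updates (V : choiceType) (op : operation V) (G G' : graph V) :
    Prop :=
  match op with
  | InsertVertex v A =>
      [/\ v \notin verts G, A `<=` verts G, verts G' = v |` verts G
        & forall x y, adj G' x y =
            [|| adj G x y, (x == v) && (y \in A) | (y == v) && (x \in A)]]
  | DeleteVertex v =>
      [/\ v \in verts G, verts G' = verts G `\ v
        & forall x y, adj G' x y = [&& adj G x y, x != v & y != v]]
  | InsertEdge a b =>
      [/\ [&& a \in verts G, b \in verts G & a != b], ~~ adj G a b,
          verts G' = verts G
        & forall x y, adj G' x y = adj G x y || same_pair a b x y]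
  | DeleteEdge a b =>
      [/\ adj G a b, verts G' = verts G
        & forall x y, adj G' x y = adj G x y && ~~ same_pair a b x y]
  end.

(* [op i] is the update that turns [G i] into [G i.+1]. *)
Definition dynamic_graph (V : choiceType) (G : nat -> graph V)
    (op : nat -> operation V) : Prop :=
  forall i, updates (op i) (G i) (G i.+1).

Definition touched (V : choiceType) (op : operation V) : {fset V} :=
  match op with
  | InsertVertex v _ | DeleteVertex v => [fset v]
  | InsertEdge a b | DeleteEdge a b => [fset a; b]
  end.

(* Both graphs are needed: the neighbours of an inserted vertex are found in
   the new graph, those of a deleted vertex in the old one.  For an edge update
   the two closed neighbourhoods coincide. *)
Definition op_nbhd (V : choiceType) (op : operation V) (G G' : graph V) :
    {fset V} :=
  cnbhds G (touched op) `|` cnbhds G' (touched op).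

Definition Iof (V : choiceType) (G : graph V) (I : {fset V}) (v : V) :
    {fset V} :=
  nbhd G v `&` I.

Definition icount (V : choiceType) (G : graph V) (I : {fset V}) (v : V) : nat :=
  #|` Iof G I v|.

Definition Ibar (V : choiceType) (G : graph V) (I : {fset V}) (j : nat)
    (S : {fset V}) : {fset V} :=
  [fset v in verts G | [&& v \notin I, 1 <= icount G I v <= j
                         & Iof G I v `<=` S]].

Definition repaired (V : choiceType) (op : operation V) (I I1 : {fset V}) :
    Prop :=
  match op with
  | InsertEdge a b =>
      if (a \in I) && (b \in I) then I1 = I `\ a \/ I1 = I `\ b else I1 = I
  | DeleteVertex v => I1 = I `\ v
  | InsertVertex _ _ | DeleteEdge _ _ => I1 = I
  end.

Inductive add_free (V : choiceType) (G : graph V) (I : {fset V}) :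
    {fset V} -> Prop :=
  | AddFree u of u \in verts G & u \notin I & icount G I u = 0 :
      add_free G I (u |` I).

Definition completes (V : choiceType) (G : graph V) (I J : {fset V}) : Prop :=
  clos_refl_trans_1n _ (add_free G) I J /\ maximal_independent G J.

(* The value at [S] is C(S), and is empty when there is no pair for [S].  The
   framework only ever stores nonempty C(S), and the index of the collection
   that holds S is always its cardinality. *)
Definition candidates (V : choiceType) := {fset V} -> {fset V}.

Definition in_collection (V : choiceType) (C : candidates V) (j : nat)
    (S : {fset V}) : Prop :=
  #|` S| = j /\ C S != fset0.

Definition smallest_nonempty (V : choiceType) (k : nat) (C : candidates V)
    (j : nat) : Prop :=
  [/\ 1 <= j <= k, exists S, in_collection C j S
    & forall j', 1 <= j' < j -> forall S, ~ in_collection C j' S].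

Definition all_empty (V : choiceType) (k : nat) (C : candidates V) : Prop :=
  forall j, 1 <= j <= k -> forall S, ~ in_collection C j S.

Definition no_candidates {V : choiceType} : candidates V := fun=> fset0.

Definition remove_pair (V : choiceType) (C : candidates V) (S : {fset V}) :
    candidates V :=
  fun S' => if S' == S then fset0 else C S'.

Definition collect (V : choiceType) (k : nat) (G : graph V) (I : {fset V})
    (A : {fset V}) (C : candidates V) : candidates V :=
  fun S => C S `|` [fset u in A | [&& u \in verts G, u \notin I,
                                      1 <= icount G I u <= k
                                    & Iof G I u == S]].

Definition promote (V : choiceType) (k : nat) (I S : {fset V}) (A : {fset V})
    (C : candidates V) : candidates V :=
  fun S' => if [&& #|` S|.+1 <= k, S `<` S', S' `<=` I & #|` S'| == #|` S|.+1]
            then C S' `|` A else C S'.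

(* A swap made elsewhere may change the neighbours in I of a vertex v stored in
   C(S), so membership in [Ibar] is tested when the pair is used and not
   when v is stored: a vertex that fails the test yields no swap for this S,
   but it stays in C(S) and is passed on to the supersets of S. *)
Definition yields (V : choiceType) (G : graph V) (I : {fset V}) (j : nat)
    (S : {fset V}) (v : V) (IS : {fset V}) : Prop :=
  [/\ v \in Ibar G I j S, IS `<=` Ibar G I j S `\` cnbhd G v,
      independent G IS & #|` IS| = j].

Definition state (V : choiceType) := ({fset V} * candidates V)%type.

Inductive loop_step (V : choiceType) (k : nat) (G : graph V) :
    state V -> state V -> Prop :=
  | Discard I C j S of
      smallest_nonempty k C j & in_collection C j S & ~~ (S `<=` I) :
      loop_step k G (I, C) (I, remove_pair C S)
  | Swap I C j S v IS I' of
      smallest_nonempty k C j & in_collection C j S & S `<=` I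
      & v \in C S & yields G I j S v IS
      & completes G ((I `\` S) `|` (v |` IS)) I' :
      loop_step k G (I, C)
        (I', collect k G I' (cnbhds G S) (remove_pair C S))
  | Promote I C j S of
      smallest_nonempty k C j & in_collection C j S & S `<=` I
      & (forall v IS, v \in C S -> ~ yields G I j S v IS) :
      loop_step k G (I, C) (I, promote k I S (C S) (remove_pair C S)).

(* [processes k op G G' I I'] : on the update [op] from [G] to [G'], started
   with the solution [I], some run of the framework terminates with output
   [I'].  All the choices that the framework leaves open are nondeterministic. *)
Definition processes (V : choiceType) (k : nat) (op : operation V)
    (G G' : graph V) (I I' : {fset V}) : Prop :=
  exists I1 I2 : {fset V}, exists C : candidates V,
    [/\ repaired op I I1, completes G' I1 I2,
        clos_refl_trans_1n _ (loop_step k G')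
          (I2, collect k G' I2 (op_nbhd op G G') no_candidates) (I', C)
      & all_empty k C].

Inductive maintained (V : choiceType) (k : nat) (G : nat -> graph V)
    (op : nat -> operation V) (I0 : {fset V}) : nat -> {fset V} -> Prop :=
  | MaintainedStart : maintained k G op I0 0 I0
  | MaintainedUpdate i I I' of
      maintained k G op I0 i I & processes k (op i) (G i) (G i.+1) I I' :
      maintained k G op I0 i.+1 I'.

(* Main.v *)
(** Loop invariant: for at most [k] solution vertices [S] and a larger
    independent set [T] outside [I] whose solution neighbours all lie in [S],
    some vertex of [T] is stored in [C(S')] for some nonempty [S'] included in
    [S].  It is preserved in whatever order the pairs are treated, and gives
    [k]-maximality once all the collections are empty.  It holds because a [T]
    avoiding the closed neighbourhood of the vertices swapped out, or touched by
    the update, was already exchangeable for [S `&` I] before the change: for a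
    swap, the vertex of [T] covering that older exchange is still stored; for
    the update, the old solution was not [k]-maximal. *)

Require Import Defs.
From Stdlib Require Import Relation_Operators.
From mathcomp Require Import all_boot finmap.

Set Implicit Arguments.
Unset Strict Implicit.
Unset Printing Implicit Defensive.

Local Open Scope fset_scope.

(** Elements of [B] are added to [A] one at a time. *)
Lemma fsubset_card_between (K : choiceType) (A B : {fset K}) n :
  A `<=` B -> #|` A| <= n <= #|` B| ->
  exists D : {fset K}, [/\ A `<=` D, D `<=` B & #|` D| = n].
Proof.
move=> sAB /andP[leAn]; elim: n leAn => [|n IHn] leAn lenB.
  by exists A; split=> //; apply/eqP; rewrite -leqn0.
case: (ltngtP #|` A| n.+1) leAn => // [ltAn _|eqAn _]; last by exists A.
have [D [sAD sDB cD]] := IHn ltAn (ltnW lenB).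
have /fsubsetPn [x xB xD] : ~~ (B `<=` D).
  by apply/negP=> /fsubset_leq_card; rewrite cD leqNgt lenB.
exists (x |` D); split.
- by apply: fsubset_trans sAD _; apply: fsubsetUr.
- by rewrite fsubUset sDB andbT fsub1set.
- by rewrite cardfsU1 xD cD.
Qed.

Section Framework.

Variable V : choiceType.
Implicit Types (G : graph V) (I S T D : {fset V}) (C : candidates V).

(** * Neighbourhoods and independent sets *)

Lemma in_nbhd G u x : (x \in nbhd G u) = adj G u x.
Proof.
rewrite !inE /= andb_idl // adj_sym; exact: adj_verts.
Qed.

Lemma in_Iof G I u x : (x \in Iof G I u) = adj G u x && (x \in I).
Proof. by rewrite in_fsetI in_nbhd. Qed.

Lemma in_cnbhds G S u :
  reflect (u \in S \/ exists2 x, x \in S & adj G u x) (u \in cnbhds G S).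
Proof.
rewrite in_fsetU; apply: (iffP orP) => -[uS|].
- by left.
- rewrite !inE => /andP[_ /existsP[x ux]]; right.
  by exists (val x); first exact: valP.
- by left.
- case=> x xS ux; right; rewrite !inE /= (adj_verts ux) /=.
  by apply/existsP; exists [` xS].
Qed.

Lemma independent_sub G I J : independent G I -> J `<=` I -> independent G J.
Proof.
move=> [sI nI] sJI; split; first exact: fsubset_trans sI.
by move=> u v uJ vJ; apply: nI; apply: (fsubsetP sJI).
Qed.

Lemma maximal_Iof_neq0 G I u :
  maximal_independent G I -> u \in verts G -> u \notin I -> Iof G I u != fset0.
Proof.
move=> [[sI nI] maxI] uG uI; apply/negP=> /eqP Iu0.
have nu x : x \in I -> ~~ adj G u x.
  by move=> xI; apply/negP=> ux; have := in_fset0 x; rewrite -Iu0 in_Iof ux xI.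
have: u |` I = I.
  apply: maxI; last exact: fsubsetUr.
  split; first by rewrite fsubUset sI fsub1set uG.
  move=> x y; rewrite !in_fset1U.
  case/predU1P=> [->|xI] /predU1P[->|yI].
  - by rewrite adj_irr.
  - exact: nu.
  - by rewrite adj_sym nu.
  - exact: nI.
by move/fsetP/(_ u); rewrite in_fset1U eqxx (negPf uI).
Qed.

(** * Exchanges and their transport between graphs *)

(** A swap without its size condition, tested at each vertex of [T] separately; this local form
    survives changes far from [T]. *)
Definition exchange G I S T : Prop :=
  [/\ S `<=` I, independent G T
    & forall u, u \in T -> u \notin I /\ Iof G I u `<=` S].

(** A vertex of [T] has a neighbour in the maximal set [I], and [S] contains it. This gives the
    bound [1 <= j] required by [k_maximal]. *)
Lemma exchange_card_gt0 G I S T :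
  maximal_independent G I -> exchange G I S T -> T != fset0 -> 0 < #|` S|.
Proof.
move=> maxI [_ [sT _] eT] /fset0Pn[u uT]; have [uI sIu] := eT u uT.
rewrite cardfs_gt0 -fproper0; apply: fproper_sub_trans sIu.
by rewrite fproper0 maximal_Iof_neq0 // (fsubsetP sT).
Qed.

(** An edge from [T] to a solution vertex that stays is exactly a solution neighbour outside [S]. *)
Lemma exchange_swap G I S T :
  independent G I ->
  exchange G I S T <->
  [/\ S `<=` I, [disjoint T & I] & independent G ((I `\` S) `|` T)].
Proof.
move=> [sI nI]; split=> [[sSI [sT nT] eT]|[sSI dTI [sU nU]]].
  split=> //; first by apply/fdisjointP=> u /eT[].
  have nTI u x : u \in T -> x \in I `\` S -> ~~ adj G u x.
    rewrite in_fsetD => uT /andP[xS xI]; apply/negP=> ux.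
    have [_ /fsubsetP/(_ x)] := eT u uT.
    by rewrite in_Iof ux xI (negPf xS) => /(_ isT).
  split; first by rewrite fsubUset sT (fsubset_trans (fsubsetDl _ _) sI).
  move=> x y; rewrite !in_fsetU => /orP[xI|xT] /orP[yI|yT].
  - by move: xI yI; rewrite !in_fsetD => /andP[_ xI] /andP[_ yI]; apply: nI.
  - by rewrite adj_sym nTI.
  - exact: nTI.
  - exact: nT.
split=> //; first by apply: independent_sub (fsubsetUr (I `\` S) T).
move=> u uT; split; first exact: (fdisjointP dTI).
apply/fsubsetP=> x; rewrite in_Iof => /andP[ux xI].
apply: contraLR ux => xS; apply: nU; first by rewrite in_fsetU uT orbT.
by rewrite in_fsetU in_fsetD xS xI.
Qed.

Lemma exchange_swap_available G I S T :
  independent G I -> exchange G I S T -> #|` S| < #|` T| ->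
  swap_available G I #|` S|.
Proof. by move=> iI /(exchange_swap S T iI)[sSI dTI iU] ltST; exists S, T. Qed.

(** Only vertices of [D] may leave the solution, and none of them is in or next to [T]. So the old
    solution neighbours of [T] all survive in [I'], hence lie in [S]; vertices gained by [I'] only
    restrict exchanges further. *)
Lemma exchange_transport G G' I I' D S T :
  I `\` D `<=` I' ->
  {in T, forall u, u \in verts G' -> u \in verts G} ->
  {in T, forall u, u \notin cnbhds G D} ->
  {in T, forall u x, adj G' u x = adj G u x} ->
  exchange G' I' S T -> exchange G I (S `&` I) T.
Proof.
move=> sII' vT dT aT [sSI' [sT nT] eT]; split; first exact: fsubsetIr.
  split; first by apply/fsubsetP=> u uT; apply: vT (fsubsetP sT u uT).
  by move=> u v uT vT'; rewrite -aT // nT.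
move=> u uT; have [uI' sIu] := eT u uT; split.
  apply: contra uI' => uI; apply: (fsubsetP sII'); rewrite in_fsetD uI andbT.
  by apply: contra (dT u uT) => uD; apply/in_cnbhds; left.
apply/fsubsetP=> x; rewrite in_Iof in_fsetI => /andP[ux xI]; rewrite xI andbT.
apply: (fsubsetP sIu); rewrite in_Iof aT // ux; apply: (fsubsetP sII').
rewrite in_fsetD xI andbT.
by apply: contra (dT u uT) => xD; apply/in_cnbhds; right; exists x.
Qed.

Lemma yields_of_exchange G I S T v :
  maximal_independent G I -> exchange G I S T -> #|` S| < #|` T| -> v \in T ->
  exists IS, yields G I #|` S| S v IS.
Proof.
move=> maxI [sSI iT eT] ltST vT.
have sTbar : T `<=` Ibar G I #|` S| S.
  apply/fsubsetP=> u uT; have [uI sIu] := eT u uT.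
  have uG : u \in verts G by apply: (fsubsetP iT.1).
  rewrite !inE /= uG uI sIu andbT /=.
  by rewrite /icount cardfs_gt0 maximal_Iof_neq0 //= fsubset_leq_card.
have cTv : #|` T| = #|` T `\ v|.+1 by rewrite (cardfsD1 v T) vT.
have [|IS [_ sIS cIS]] :=
  fsubset_card_between (n := #|` S|) (fsub0set (T `\ v)).
  by rewrite cardfs0 -[X in _ && X]ltnS -cTv.
exists IS; split=> //; first exact: (fsubsetP sTbar).
- apply/fsubsetP=> u /(fsubsetP sIS); rewrite in_fsetD1 => /andP[uv uT].
  rewrite in_fsetD (fsubsetP sTbar) // andbT in_fset1U in_nbhd negb_or uv.
  exact: iT.2.
- by apply: independent_sub iT (fsubset_trans sIS (fsubD1set _ _)).
Qed.

(** * The covering invariant *)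

(** [S'] may be smaller than [S], since a stored vertex climbs to larger sets by promotion. It is
    nonempty because [all_empty] concerns indices from 1 on. *)
Definition covered k G I C : Prop :=
  forall S T, exchange G I S T -> #|` S| <= k -> #|` S| < #|` T| ->
  exists v S', [/\ v \in T, S' `<=` S, S' != fset0 & v \in C S'].

Lemma covered_k_maximal k G I C :
  maximal_independent G I -> covered k G I C -> all_empty k C ->
  k_maximal k G I.
Proof.
move=> maxI covC C0; split=> // j /andP[_ lejk] [S [T [sSI cS dTI ltST iU]]].
have eST : exchange G I S T by apply/(exchange_swap S T maxI.1).
rewrite -cS in lejk ltST.
have [v [S' [vT sS' nzS' vC]]] := covC S T eST lejk ltST.
case: (C0 #|` S'| _ S').
  by rewrite cardfs_gt0 nzS' (leq_trans (fsubset_leq_card sS')).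
by split=> //; apply/fset0Pn; exists v.
Qed.

Lemma mem_collect k G I A C S T u :
  maximal_independent G I -> exchange G I S T -> #|` S| <= k ->
  u \in T -> u \in A -> u \in collect k G I A C (Iof G I u).
Proof.
move=> maxI [_ [sT _] eT] leSk uT uA; have [uI sIu] := eT u uT.
have uG : u \in verts G by apply: (fsubsetP sT).
rewrite in_fsetU !inE /= uA uG uI eqxx /icount cardfs_gt0.
by rewrite maximal_Iof_neq0 //= (leq_trans (fsubset_leq_card sIu)) // orbT.
Qed.

(** A vertex [u] of [T] in [A] has just been stored at [Iof G I u], a subset of [S]; only the [T]
    that avoid [A] need an argument. *)
Lemma covered_collect k G I A C :
  maximal_independent G I ->
  (forall S T, exchange G I S T -> #|` S| <= k -> #|` S| < #|` T| ->
     {in T, forall u, u \notin A} ->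
     exists v S', [/\ v \in T, S' `<=` S, S' != fset0 & v \in C S']) ->
  covered k G I (collect k G I A C).
Proof.
move=> maxI covC S T eST leSk ltST.
have [/hasP[u uT uA]|/hasPn nTA] := boolP (has [in A] T).
  have [_ [sT _] /(_ u uT)[uI sIu]] := eST.
  exists u, (Iof G I u); split=> //.
    by rewrite maximal_Iof_neq0 // (fsubsetP sT).
  exact: mem_collect eST _ _ _.
have [v [S' [vT sS' nzS' vC]]] := covC S T eST leSk ltST nTA.
by exists v, S'; split=> //; rewrite in_fsetU vC.
Qed.

(** * Preservation by the steps of the loop *)

Lemma add_free_sub G I J :
  clos_refl_trans_1n _ (add_free G) I J -> I `<=` J.
Proof.
by elim=> // {}I _ {}J [u _ _ _] _; apply: fsubset_trans; apply: fsubsetUr.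
Qed.

Lemma covered_restrict k G I C S T :
  maximal_independent G I -> covered k G I C ->
  exchange G I (S `&` I) T -> #|` S| <= k -> #|` S| < #|` T| ->
  exists v S', [/\ v \in T, S' `<=` S, S' != fset0 & v \in C S'].
Proof.
move=> maxI covC eT leSk ltST.
have leSI : #|` S `&` I| <= #|` S| by apply/fsubset_leq_card/fsubsetIl.
have [v [S' [vT sS' nzS' vC]]] :=
  covC _ _ eT (leq_trans leSI leSk) (leq_ltn_trans leSI ltST).
by exists v, S'; split=> //; apply: fsubset_trans sS' (fsubsetIl _ _).
Qed.

Lemma covered_discard k G I C S :
  ~~ (S `<=` I) -> covered k G I C -> covered k G I (remove_pair C S).
Proof.
move=> nSI covC S1 T eT leSk ltST.
have [v [S' [vT sS' nzS' vC]]] := covC S1 T eT leSk ltST.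
exists v, S'; split=> //; rewrite /remove_pair; case: eqP => // eS.
by have [sS1I _ _] := eT; rewrite -eS (fsubset_trans sS') in nSI.
Qed.

(** If the vertex stored at [S] covers an exchange for [S] itself, the test would have succeeded.
    Otherwise [S] is proper in [S1], and a set [S2] between them with one more element than [S]
    receives the vertex. *)
Lemma covered_promote k G I C S :
  maximal_independent G I ->
  (forall v IS, v \in C S -> ~ yields G I #|` S| S v IS) ->
  covered k G I C -> covered k G I (promote k I S (C S) (remove_pair C S)).
Proof.
move=> maxI noY covC S1 T eT leSk ltST.
have [v [S' [vT sS' nzS' vC]]] := covC S1 T eT leSk ltST.
have [eS|neS] := eqVneq S' S; last first.
  exists v, S'; split=> //; rewrite /promote /remove_pair (negPf neS).
  by case: ifP; rewrite ?in_fsetU vC.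
subst S'; have [eS1|neS1] := eqVneq S S1.
  subst S1; have [IS yIS] := yields_of_exchange maxI eT ltST vT.
  by case: (noY v IS vC).
have ltS : #|` S| < #|` S1|.
  by apply: fproper_ltn_card; rewrite fproperEneq neS1.
have [|S2 [sS2 sS21 cS2]] := fsubset_card_between (n := #|` S|.+1) sS'.
  by rewrite leqnSn ltS.
have [sS1I _ _] := eT.
have nzS2 : S2 != fset0 by rewrite -cardfs_gt0 cS2.
exists v, S2; split=> //; rewrite /promote cS2 eqxx (leq_trans ltS leSk).
rewrite fproperEcard sS2 cS2 leqnn (fsubset_trans sS21 sS1I).
by rewrite in_fsetU vC orbT.
Qed.

(** A [T] avoiding [cnbhds G S] was exchangeable before the swap, so a vertex of it was stored at
    some subset of [S1]. That subset is not the removed [S], as [S1] lies in [I'] and [S] does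
    not. *)
Lemma covered_swap k G I C S v IS j I' :
  maximal_independent G I -> yields G I j S v IS ->
  completes G ((I `\` S) `|` (v |` IS)) I' ->
  covered k G I C ->
  covered k G I' (collect k G I' (cnbhds G S) (remove_pair C S)).
Proof.
move=> maxI [vbar _ _ _] [growI' maxI'] covC.
have := add_free_sub growI'; rewrite !fsubUset fsub1set => /and3P[sII' vI' _].
(* A solution neighbour of [v] lies in [S], so [S] cannot be re-added whole. *)
have nSI' : ~~ (S `<=` I').
  move: vbar; rewrite !inE /= => /and4P[_ _ /andP[Iv0 _] sIvS].
  move: Iv0; rewrite /icount cardfs_gt0 => /fset0Pn[x xIv].
  apply/negP=> /fsubsetP/(_ x (fsubsetP sIvS x xIv)) xI'.
  by move: xIv; rewrite in_Iof (negPf (maxI'.1.2 _ _ vI' xI')).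
apply: covered_collect => // S1 T eT leSk ltST nTS.
have eT' : exchange G I (S1 `&` I) T.
  by apply: (exchange_transport sII' _ nTS _ eT).
have [w [S' [wT sS' nzS' wC]]] := covered_restrict maxI covC eT' leSk ltST.
exists w, S'; split=> //; rewrite /remove_pair; case: eqP => // eS.
by have [sS1I' _ _] := eT; rewrite -eS (fsubset_trans sS') in nSI'.
Qed.

Definition loop_inv k G (s : state V) : Prop :=
  maximal_independent G s.1 /\ covered k G s.1 s.2.

Lemma loop_step_inv k G s s' :
  loop_step k G s s' -> loop_inv k G s -> loop_inv k G s'.
Proof.
(* In the promotion case the index [j] is replaced by the cardinality of [S]. *)
case=> [I C j S _ _ nSI|I C j S v IS I' _ _ _ _ y c|I C j S _ [<- _] _ noY];
  case=> /= maxI covC; split=> //=.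
- exact: covered_discard.
- by case: c.
- exact: covered_swap y c covC.
- exact: covered_promote.
Qed.

Lemma loop_steps_inv k G s s' :
  clos_refl_trans_1n _ (loop_step k G) s s' ->
  loop_inv k G s -> loop_inv k G s'.
Proof. by elim=> // {}s s1 {}s' /loop_step_inv st _ IH /st. Qed.

(** * Effect of one update *)

Lemma repaired_sub op I I1 : repaired op I I1 -> I `\` touched op `<=` I1.
Proof.
case: op => [v A|v|a b|a b] /=; try by move=> ->; rewrite ?fsubsetDl.
case: ifP => _; last by move=> ->; apply: fsubsetDl.
by case=> ->; apply: fsetDS; rewrite fsub1set !inE eqxx ?orbT.
Qed.

(** Only pairs with a touched end can change. Here [u] is not touched, and if [x] is, then [u] is
    adjacent to it in neither graph. *)
Lemma updates_adj op G G' u x :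
  updates op G G' -> u \notin op_nbhd op G G' -> adj G' u x = adj G u x.
Proof.
move=> upd; rewrite in_fsetU negb_or => /andP[/in_cnbhds nG /in_cnbhds nG'].
have ut : u \notin touched op by apply/negP=> ?; apply: nG; left.
have [xt|xt] := boolP (x \in touched op).
  have -> : adj G u x = false by apply/negP=> ux; apply: nG; right; exists x.
  by apply/negP=> ux; apply: nG'; right; exists x.
case: op upd ut xt {nG nG'} => [v A|v|a b|a b] /=; rewrite !inE.
- by case=> _ _ _ -> /negPf-> /negPf->; rewrite /= orbF.
- by case=> _ _ -> -> ->; rewrite !andbT.
- case=> _ _ _ ->; rewrite !negb_or /same_pair.
  by move=> /andP[/negPf-> /negPf->]; rewrite orbF.
- case=> _ _ ->; rewrite !negb_or /same_pair.
  by move=> /andP[/negPf-> /negPf->]; rewrite andbT.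
Qed.

Lemma updates_verts op G G' u :
  updates op G G' -> u \notin touched op -> u \in verts G' -> u \in verts G.
Proof.
case: op => [v A|v|a b|a b] /= [].
- by move=> _ _ -> _; rewrite !inE => /negPf->.
- by move=> _ -> _ _; rewrite in_fsetD1 => /andP[].
- by move=> _ _ ->.
- by move=> _ ->.
Qed.

Lemma processes_k_maximal k op G G' I I' :
  updates op G G' -> k_maximal k G I -> processes k op G G' I I' ->
  k_maximal k G' I'.
Proof.
move=> upd [maxI noswap] [I1 [I2 [C [rep [grow maxI2] run C0]]]].
suff [maxI' covC] : loop_inv k G' (I', C) by apply: covered_k_maximal C0.
apply: loop_steps_inv run _; split=> //=; apply: covered_collect => //.
move=> S T eT leSk ltST nT.
have ntG u : u \in T -> u \notin cnbhds G (touched op).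
  by move=> /nT; rewrite in_fsetU negb_or => /andP[].
have eT' : exchange G I (S `&` I) T.
  apply: (exchange_transport _ _ ntG _ eT).
  - exact: fsubset_trans (repaired_sub rep) (add_free_sub grow).
  - move=> u uT; have nu := ntG u uT; apply: updates_verts upd _.
    by apply: contra nu => ut; apply/in_cnbhds; left.
  - by move=> u /nT nu x; apply: updates_adj upd nu.
(* The transported exchange is a swap in the old solution, of size between 1 and [k], which [noswap]
   excludes. *)
have leSI : #|` S `&` I| <= #|` S| by apply/fsubset_leq_card/fsubsetIl.
have nzT : T != fset0 by rewrite -cardfs_gt0 (leq_trans _ ltST).
case: (noswap #|` S `&` I|).
  by rewrite (exchange_card_gt0 maxI eT' nzT) (leq_trans leSI).
exact: exchange_swap_available maxI.1 eT' (leq_ltn_trans leSI ltST).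
Qed.

End Framework.

Theorem theorem5 (V : choiceType) (k : nat) (G : nat -> graph V)
    (op : nat -> operation V) (I0 : {fset V}) :
  1 <= k ->
  dynamic_graph G op ->
  k_maximal k (G 0) I0 ->
  forall (i : nat) (I : {fset V}),
    maintained k G op I0 i I -> k_maximal k (G i) I.
Proof.
move=> _ dynG max0 i I; elim=> // {}i {}I I' _ maxI proc.
exact: processes_k_maximal (dynG i) maxI proc.
Qed.
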